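(* Let $\phi_1:[0,1]\to[0,1]$ be the infinitely piecewise linear map with parameter $k=1$, i.e. $\phi_1(x)=x-\frac12$ for $x\in[\frac12,1]$, and $\phi_1(x)=2^i\left(x-\frac{1}{2^i}\right)$ for $x\in[2^{-i},2^{1-i})$, $i=2,3,\ldots$ (with $\phi_1(0)=0$). Then the invariant density of $\phi_1$ is $$\rho^{(1)}(x)=\begin{cases}\frac43, & x\in\left[0,\frac12\right),\\[2pt] \frac23, & x\in\left[\frac12,1\right].\end{cases}$$
   Context: An invariant density of a Borel measurable map $\phi:[0,1]\to[0,1]$ is a probability density $\rho$ on $[0,1]$ with respect to Lebesgue measure (i.e. $\rho\ge 0$ is measurable and $\int_0^1\rho(x)\,dx=1$) such that the measure $\mu(A)=\int_A\rho(x)\,dx$ is $\phi$-invariant: $\mu(\phi^{-1}(A))=\mu(A)$ for every Borel set $A\subseteq[0,1]$. Equivalently, $\rho$ is a fixed point of the Perron–Frobenius operator of $\phi$. Densities that are equal Lebesgue-almost everywhere are identified. *)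

(* Defs.v *)
From HB Require Import structures.
From mathcomp Require Import all_boot all_order all_algebra.
From mathcomp Require Import all_classical all_reals all_analysis.
From mathcomp Require Import measurable_realfun ring lra.

Set Implicit Arguments.
Unset Strict Implicit.
Unset Printing Implicit Defensive.

Import Order.TTheory GRing.Theory Num.Theory.
Import numFieldNormedType.Exports.

Local Open Scope classical_set_scope.
Local Open Scope ring_scope.

(* A map [0,1] -> [0,1] and a density on [0,1] are given by functions R -> R
   of which only the values on [0,1] matter. *)

Section invariant_density.
Context {R : realType}.
Implicit Types (phi rho : R -> R) (A : set R).

Definition probability_density rho : Prop :=
  [/\ measurable_fun (`[0, 1] : set R) rho,
      (forall x, x \in `[0, 1] -> 0 <= rho x) &
      (\int[lebesgue_measure]_(x in `[0%R, 1%R]) (rho x)%:E = 1)%E].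

Definition density_measure rho A : \bar R :=
  (\int[lebesgue_measure]_(x in A) (rho x)%:E)%E.

(* The preimage is taken in [0,1].  The notion is only meant for phi mapping
   [0,1] to itself and Borel measurable there (for phi1 below, see phi1_itv and
   measurable_phi1). *)
Definition invariant_density phi rho : Prop :=
  probability_density rho /\
  forall A, measurable A -> A `<=` `[0, 1] ->
    density_measure rho (`[0, 1] `&` phi @^-1` A) = density_measure rho A.

(* Equality of densities: equality Lebesgue-almost everywhere on [0,1]. *)
Definition ae_eq01 (rho rho' : R -> R) : Prop :=
  {ae lebesgue_measure, forall x, x \in `[0, 1] -> rho x = rho' x}.

End invariant_density.

Section phi1.
Context {R : realType}.
Implicit Type x : R.

(* x lies in [2^-i, 2^(1-i)), with i >= 2. *)
Definition in_branch x (i : nat) : Prop :=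
  (2 <= i)%N /\ 2 ^- i <= x < 2 ^- i.-1.

(* For 0 < x < 1/2 exactly one i satisfies in_branch x i, and xget returns it;
   see phi1_branch and phi1_cover. *)
Definition phi1 x : R :=
  if 1 / 2 <= x then x - 1 / 2
  else if 0 < x then
    let i := xget 0%N [set i | in_branch x i] in 2 ^+ i * (x - 2 ^- i)
  else 0.

Definition rho1 x : R := if x < 1 / 2 then 4 / 3 else 2 / 3.

Lemma phi1_0 : phi1 0 = 0.
Proof. by rewrite /phi1 ltxx ifF//; apply/negbTE; rewrite -ltNge; lra. Qed.

Lemma phi1_right x : x \in `[1 / 2, 1] -> phi1 x = x - 1 / 2.
Proof. by rewrite in_itv /= /phi1 => /andP[-> _]. Qed.

Lemma in_branch_inj x i j : in_branch x i -> in_branch x j -> i = j.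
Proof.
wlog ij : i j / (i < j)%N.
  move=> H xi xj; case: (ltngtP i j) => // ij; first exact: H.
  by apply/esym/H.
move=> [i2 /andP[ix _]] [j2 /andP[_ xj]].
suff : 2 ^- j.-1 <= 2 ^- i :> R by move=> /(lt_le_trans xj); rewrite ltNge ix.
rewrite lef_pV2 ?posrE ?exprn_gt0// ler_eXn2l ?ltr1n//.
by rewrite -ltnS prednK// (leq_trans _ ij).
Qed.

Lemma in_branch_itv x i : in_branch x i -> 0 < x < 1 / 2.
Proof.
move=> [i2 /andP[ix xi]]; rewrite (lt_le_trans _ ix) ?invr_gt0 ?exprn_gt0//=.
rewrite (lt_le_trans xi)// mul1r lef_pV2 ?posrE ?exprn_gt0//.
by rewrite -{1}(expr1 2) ler_eXn2l ?ltr1n// -ltnS prednK// ltnW.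
Qed.

Lemma phi1_branch x i : (2 <= i)%N -> x \in `[2 ^- i, 2 ^- i.-1[ ->
  phi1 x = 2 ^+ i * (x - 2 ^- i).
Proof.
rewrite in_itv /= => i2 ix; have xi : in_branch x i by split.
have /andP[x0 x2] := in_branch_itv xi.
rewrite /phi1 leNgt x2 x0 /= (xget_subset1 0%N xi)// => a b.
exact: in_branch_inj.
Qed.

Lemma phi1_cover x : 0 < x < 1 / 2 ->
  exists2 i, (2 <= i)%N & x \in `[2 ^- i, 2 ^- i.-1[.
Proof.
move=> /andP[x0 x2].
have ex : exists n, 2 ^- n <= x.
  exists (Num.bound x^-1); rewrite invf_ple ?posrE ?exprn_gt0//.
  rewrite ltW// (lt_trans (archi_boundP _)) ?invr_ge0 ?ltW//.
  by rewrite -natrX ltr_nat ltn_expl.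
case: (ex_minnP ex) => i ix imin.
have i2 : (2 <= i)%N.
  rewrite leqNgt; apply/negP => i1; move: ix; apply/negP; rewrite -ltNge.
  rewrite (lt_le_trans x2)// mul1r lef_pV2 ?posrE ?exprn_gt0//.
  by rewrite -{2}(expr1 2) ler_eXn2l ?ltr1n.
exists i => //; rewrite in_itv /= ix /= ltNge; apply/negP => /imin.
by rewrite -ltnS prednK ?ltnn// ltnW.
Qed.

Lemma phi1_itv x : x \in `[0, 1] -> phi1 x \in `[0, 1].
Proof.
rewrite !in_itv /= => /andP[x0 x1].
have [x2|x2] := leP (1 / 2) x.
  by rewrite phi1_right ?in_itv /= ?x2//; lra.
move: x0; rewrite le_eqVlt => /predU1P[<-|x0]; first by rewrite phi1_0 lexx ler01.
have [|i i2 xi] := @phi1_cover x; first by rewrite x0.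
rewrite (phi1_branch i2 xi); move: xi; rewrite in_itv /= => /andP[ix xi].
have p0 : 0 < 2 ^+ i :> R by rewrite exprn_gt0.
rewrite mulr_ge0 ?subr_ge0// ?(ltW p0)//=.
rewrite mulrBr divff ?gt_eqF// lerBlDr.
have -> : 1 + 1 = 2 ^+ i * 2 ^- i.-1 :> R.
  rewrite -{1}(prednK (ltnW i2)) exprS mulfK ?expf_neq0 ?pnatr_eq0//.
by rewrite ler_pM2l// ltW.
Qed.

Lemma measurable_phi1 : measurable_fun setT (phi1 : R -> R).
Proof.
pose B (i : nat) : set R :=
  if i is 0%N then `]-oo, 0]%classic else if i is 1%N then `[1 / 2, +oo[%classic
  else `[2 ^- i, 2 ^- i.-1[%classic.
have -> : [set: R] = \bigcup_i B i.
  apply/esym/seteqP; split => // x _.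
  have [x0|x0] := leP x 0; first by exists 0%N => //=; rewrite in_itv.
  have [x2|x2] := leP (1 / 2) x.
    by exists 1%N => //=; rewrite in_itv/= x2.
  have [|i i2 xi] := @phi1_cover x; first by rewrite x0.
  by exists i => //; case: i i2 xi => [|[|i]].
apply/measurable_fun_bigcup => [[|[|i]] /=|[|[|i]] /=]; do ?exact: measurable_itv.
- apply: (eq_measurable_fun (fun=> 0 : R)) => [x|]; last exact: measurable_cst.
  rewrite inE /= in_itv /= => x0.
  by rewrite /phi1 ifF ?ltNge ?x0//; apply/negbTE; rewrite -ltNge; lra.
- apply: (eq_measurable_fun (fun x : R => x - 1 / 2)).
    by move=> x; rewrite inE /= in_itv /= andbT /phi1 => ->.
  exact: measurable_funB.
- apply: (eq_measurable_fun (fun x : R => 2 ^+ i.+2 * (x - 2 ^- i.+2))).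
    by move=> x; rewrite inE /= => xi; rewrite (@phi1_branch x i.+2).
  by apply: measurable_funM => //; exact: measurable_funB.
Qed.

End phi1.

(* Main.v *)
(* The first return map of phi1 to [0, 1/2[ consists of countably many full
   affine branches of slope 2^i, i >= 2.  It preserves Lebesgue measure on
   [0, 1/2[, and its n-th iterate is mixing at rate 4^-n: for B in [0, 1/2[,
   the n-th preimage of B meets [0, x[ in measure 2 x |B| up to 4^-n.  By a
   Dynkin argument and approximation by simple functions, every measure mu with
   a density that is invariant under the first return map satisfies
   mu(B) >= 2 |B| mu([0, 1/2[); applying this to the complement of B gives
   equality, so mu is a multiple of Lebesgue measure on [0, 1/2[.
   Its values on [1/2, 1] follow, because the preimage of a subset of ]1/2, 1[
   lies in [0, 1/2[, and the total mass 1 fixes the multiple. *)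
Require Import Defs.
From mathcomp Require Import all_boot all_order all_algebra.
From mathcomp Require Import all_classical all_reals all_analysis.
From mathcomp Require Import finmap measurable_realfun ring lra.

Set Implicit Arguments.
Unset Strict Implicit.
Unset Printing Implicit Defensive.

Import Order.TTheory GRing.Theory Num.Theory.
Import numFieldNormedType.Exports HBNNSimple.

Local Open Scope classical_set_scope.
Local Open Scope ring_scope.

(** * Affine changes of variable for Lebesgue measure *)

Lemma lebesgue_measure_affine (R : realType) (a b : R) (A : set R) :
  0 < a -> measurable A ->
  lebesgue_measure ((fun x => a * (x - b)) @^-1` A) =
  ((a^-1)%:E * lebesgue_measure A)%E.
Proof.
move=> a0 mA.
pose f (x : measurableTypeR R) : measurableTypeR R := a * (x - b).
have mf : measurable_fun setT f.
  by apply: measurable_funM => //; exact: measurable_funB.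
have a0' : 0 <= a by rewrite ltW.
(* The pushforward under [f], rescaled by [a], agrees with Lebesgue measure on the intervals []u,
   v]], hence on all measurable sets. *)
pose mu0 := mscale (NngNum a0') (pushforward (@lebesgue_measure R) f).
pose mu := mu0 mf.
have -> : lebesgue_measure A = mu A.
  apply: lebesgue_measure_unique => // _ [[u v] _ <-] /=.
  rewrite /mu /mu0 /mscale /= /pushforward.
  have -> : f @^-1` `]u, v]%classic = `]u / a + b, v / a + b]%classic.
    apply/seteqP; split=> x /=; rewrite !in_itv /= /f;
    by rewrite -ltrBrDr -lerBlDr ltr_pdivrMr// ler_pdivlMr// !(mulrC a).
  rewrite !lebesgue_measure_itv/= !lte_fin ltrD2r ltr_pM2r ?invr_gt0//.
  case: ifPn => _; last by rewrite mule0.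
  by rewrite -!EFinD -EFinM; congr EFin; field; rewrite gt_eqF.
by rewrite /mu /mu0 /mscale /= muleA -EFinM mulVf ?gt_eqF// mul1e.
Qed.

(** * Asymptotic independence: from a generating pi-system to all measurable sets *)

Section cvg_measureI.
Context d {T : measurableType d} {R : realType}.
Variables (mu : {finite_measure set T -> \bar R}) (A : (set T)^nat) (c : R).
Hypothesis mA : forall n, measurable (A n).

Let m (E : set T) : R := fine (mu E).

Let muE E : measurable E -> mu E = (m E)%:E.
Proof. by move=> mE; rewrite fineK// fin_num_measure. Qed.

Let mD E F : measurable E -> measurable F -> E `<=` F -> m (F `\` E) = m F - m E.
Proof.
move=> mE mF EF; apply/EFin_inj; rewrite -muE; last exact: measurableD.
rewrite measureD//; last by rewrite -ge0_fin_numE// fin_num_measure.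
by rewrite setIidr// EFinB -!muE.
Qed.

Let le_m E F : measurable E -> measurable F -> E `<=` F -> m E <= m F.
Proof.
by move=> mE mF EF; rewrite -lee_fin -!muE//; apply: le_measure => //; exact: mem_set.
Qed.

(** The sets with this property are shown to form a Dynkin system. When [c] is the limit of the
    proportion of the total mass carried by [A n], the property is asymptotic independence of [A n]
    from [E]. *)
Let asymp E := m (E `&` A n) @[n --> \oo] --> c * m E.

Let asympD E F : measurable E -> measurable F -> E `<=` F ->
  asymp E -> asymp F -> asymp (F `\` E).
Proof.
move=> mE mF EF aE aF; rewrite /asymp mD// mulrBr.
under eq_fun.
  move=> n; have -> : (F `\` E) `&` A n = (F `&` A n) `\` (E `&` A n).
    by apply/seteqP; split=> x /=; tauto.
  rewrite mD//; [|exact: measurableI|exact: measurableI|exact: setSI].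
  over.
exact: cvgB.
Qed.

Hypothesis aT : asymp setT.

Let asympC E : measurable E -> asymp E -> asymp (~` E).
Proof. by move=> mE aE; rewrite -setTD; exact: asympD. Qed.

(** Complements and proper differences suffice: [F] lies in the complement of [E], and the union is
    the complement of what remains there after removing [F]. *)
Let asympU E F : measurable E -> measurable F -> E `&` F = set0 ->
  asymp E -> asymp F -> asymp (E `|` F).
Proof.
rewrite setIC => mE mF /disjoints_subset FE aE aF.
rewrite -(setCK (E `|` F)) setCU -setDE; apply: asympC.
  by apply: measurableD => //; exact: measurableC.
apply: asympD => //; [exact: measurableC|exact: asympC].
Qed.

(** The finite unions [U k] exhaust the countable one from inside. Intersecting with [A n] can only
    shrink what [U k] misses, so the approximation error is uniform in [n]. *)
Let asymp_bigcup (F : (set T)^nat) : (forall n, measurable (F n)) ->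
  trivIset setT F -> (forall n, asymp (F n)) -> asymp (\bigcup_k F k).
Proof.
move=> mF tF aF; pose U n := \big[setU/set0]_(i < n.+1) F i.
have mU n : measurable (U n) by exact: bigsetU_measurable.
have mE : measurable (\bigcup_k F k) by exact: bigcup_measurable.
have UE n : U n `<=` \bigcup_k F k.
  by rewrite -bigcup_bigsetU_bigcup => x Ux; exists n.
have aU n : asymp (U n).
  elim: n => [|n ih]; first by rewrite /U big_ord1.
  rewrite /U big_ord_recr/=; apply: (asympU (mU n)) => //.
  rewrite /U -bigcup_mkord setI_bigcupl bigcup0// => i /= ik.
  by move/trivIsetP : tF => ->//; rewrite lt_eqF.
have mUE : m (U n) @[n --> \oo] --> m (\bigcup_k F k).
  rewrite -bigcup_bigsetU_bigcup; apply: fine_cvg.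
  rewrite -/U -muE; last by rewrite bigcup_bigsetU_bigcup.
  apply: nondecreasing_cvg_mu => //; first by rewrite bigcup_bigsetU_bigcup.
  by move=> i j ij; apply/subsetPset/subset_bigsetU.
apply/cvgrPdist_lt => e e0.
(* The error splits into three terms: the one for [U k], [c] times the missing mass, and the missing
   mass inside [A n]. They take 1, [|c|] and 1 shares of [e / (2 + |c|)]. *)
have c1 : 0 < 2 + `|c| by rewrite ltr_wpDr.
have e2 : 0 < e / (2 + `|c|) by rewrite divr_gt0.
move/cvgrPdist_lt : mUE => /(_ _ e2)[k _ /(_ k (leqnn k)) /= mUk].
move/cvgrPdist_lt : (aU k) => /(_ _ e2).
apply: filterS => n /= Ukn.
have UE1 : m (U k) <= m (\bigcup_k F k) by exact: le_m.
have UEn : m (U k `&` A n) <= m (\bigcup_k F k `&` A n).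
  by apply: le_m; [exact: measurableI|exact: measurableI|exact: setSI].
have DE : m (\bigcup_k F k `&` A n) - m (U k `&` A n) <= m (\bigcup_k F k) - m (U k).
  rewrite -!mD//; [|exact: measurableI|exact: measurableI|exact: setSI].
  apply: le_m; [| exact: measurableD|].
    by apply: measurableD; exact: measurableI.
  by move=> x /=; tauto.
move: mUk; rewrite ger0_norm ?subr_ge0// => mUk.
set a := m (\bigcup_k F k `&` A n) in UEn DE *; set b := m (U k `&` A n) in Ukn UEn DE.
set u := m (\bigcup_k F k) in UE1 DE mUk *; set v := m (U k) in Ukn UE1 DE mUk.
have -> : c * u - a = (c * v - b) + c * (u - v) - (a - b) by ring.
have cuv : `|c * (u - v)| <= `|c| * (e / (2 + `|c|)).
  by rewrite normrM ler_wpM2l// ger0_norm ?subr_ge0// ltW.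
have -> : e = e / (2 + `|c|) + `|c| * (e / (2 + `|c|)) + e / (2 + `|c|).
  by field; rewrite gt_eqF.
apply: (le_lt_trans (ler_normB _ _)); apply: ltrD.
  by apply: (le_lt_trans (ler_normD _ _)); apply: ltr_leD.
by rewrite ger0_norm ?subr_ge0// (le_lt_trans DE).
Qed.

Lemma cvg_measureI_dynkin (G : set (set T)) :
  @measurable _ T = <<s G >> -> setI_closed G ->
  (forall E, G E -> fine (mu (E `&` A n)) @[n --> \oo] --> c * fine (mu E)) ->
  forall E, measurable E ->
    fine (mu (E `&` A n)) @[n --> \oo] --> c * fine (mu E).
Proof.
move=> mG GI aG E; rewrite mG.
exact: (dynkin_induction (P := asymp) mG GI aT aG asympC asymp_bigcup).
Qed.

End cvg_measureI.

(** * From asymptotic independence of sets to a bound on integrals *)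

Lemma integral_nnsfun_sum d (T : measurableType d) (R : realType)
    (mu : {measure set T -> \bar R}) (A : set T) (g : {nnsfun T >-> R}) :
  measurable A -> (mu A < +oo)%E ->
  (\int[mu]_(x in A) (g x)%:E =
   (\sum_(y <- fset_set (range g)) y * fine (mu (g @^-1` [set y] `&` A)))%:E)%E.
Proof.
move=> mA Aoo.
under eq_integral do rewrite fimfunE -fsumEFin//.
rewrite ge0_integral_fsum//; last 2 first.
- by move=> y; apply/measurable_EFinP; exact: measurable_funM.
- by move=> y x _; rewrite nnfun_muleindic_ge0.
rewrite fsbig_finite//= -sumEFin; apply: eq_bigr => y _.
rewrite integralZl_indic_nnsfun// integral_indic// EFinM fineK//.
rewrite ge0_fin_numE// (le_lt_trans _ Aoo)//.
by apply: measureIr => //; exact: measurable_funPTI.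
Qed.

(** For a simple function below [f] the integral over [A n] is a finite sum that converges termwise,
    and it stays below [v]. Monotone convergence then passes from the simple functions to [f]. The
    two limits are taken one after the other, first in [n], then in [k], which is why the result is
    an inequality. *)
Lemma cvg_measureI_integral_le d (T : measurableType d) (R : realType)
    (mu : {measure set T -> \bar R}) (D : set T) (A : (set T)^nat) (c : R)
    (f : T -> \bar R) (v : \bar R) :
  measurable D -> (mu D < +oo)%E -> 0 <= c ->
  (forall n, measurable (A n) /\ A n `<=` D) ->
  (forall E, measurable E ->
    fine (mu (E `&` A n)) @[n --> \oo] --> c * fine (mu (E `&` D))) ->
  measurable_fun D f -> (forall x, D x -> 0 <= f x)%E ->
  (forall n, \int[mu]_(x in A n) f x <= v)%E ->
  (c%:E * \int[mu]_(x in D) f x <= v)%E.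
Proof.
move=> mD Doo c0 AD AE mf f0 Afv.
pose g := nnsfun_approx mD mf.
have gf x : D x -> {homo (fun k => (g k x)%:E) : m n / (m <= n)%N >-> (m <= n)%E}.
  by move=> _ m n mn; rewrite lee_fin; exact/lefP/nd_nnsfun_approx.
have cvgg x : D x -> (g k x)%:E @[k --> \oo] --> f x.
  by move=> Dx; exact: cvg_nnsfun_approx.
have cvgf : (\int[mu]_(x in D) (g k x)%:E)%E @[k --> \oo] --> (\int[mu]_(x in D) f x)%E.
  rewrite (eq_integral (fun x => limn (fun k => (g k x)%:E))).
    apply: cvg_monotone_convergence => //.
    - by move=> k; apply/measurable_EFinP; exact: measurable_funTS.
    - by move=> k x _; rewrite lee_fin.
  by move=> x /set_mem Dx; apply/esym/cvg_lim => //; exact: cvgg.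
have {cvgf} cvgf : (c%:E * \int[mu]_(x in D) (g k x)%:E)%E @[k --> \oo]
    --> (c%:E * \int[mu]_(x in D) f x)%E by exact: cvgeZl.
apply: (cvge_to_le cvgf); apply: nearW => k.
rewrite integral_nnsfun_sum// -EFinM mulr_sumr.
have Aoo n : (mu (A n) < +oo)%E.
  have [mA AnD] := AD n.
  by apply: le_lt_trans Doo; apply: le_measure => //; exact: mem_set.
pose S n := \sum_(y <- fset_set (range (g k))) y * fine (mu (g k @^-1` [set y] `&` A n)).
have Sv n : ((S n)%:E <= v)%E.
  have [mA AnD] := AD n.
  rewrite -integral_nnsfun_sum//; apply: le_trans (Afv n).
  apply: ge0_le_integral => //.
  - by move=> x _; rewrite lee_fin.
  - by apply/measurable_EFinP; exact: measurable_funTS.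
  - exact: (measurable_funS mD AnD mf).
  - move=> x /AnD Dx; rewrite -(cvg_lim _ (cvgg _ Dx))//.
    apply: lime_ge; first exact: cvgP (cvgg _ Dx).
    by exists k => // j /= kj; exact: gf.
set L := \sum_(_ <- _) _.
have SL : S n @[n --> \oo] --> L.
  rewrite /S /L; apply: cvg_big => [|y _]; first exact: add_continuous.
  rewrite mulrCA; apply: cvgM; first exact: cvg_cst.
  by apply: AE; exact: measurable_funPTI.
have {}SL : (S n)%:E @[n --> \oo] --> L%:E by apply: cvg_EFin => //; exact: nearW.
by apply: (cvge_to_le SL); exact: nearW.
Qed.

(** * Lebesgue measure of preimages under [phi1] *)

Section phi1_measure.
Context {R : realType}.
Implicit Types (B C : set R) (x y : R).

Local Notation leb := (@lebesgue_measure R).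

Lemma measurable_phi1_preimage C : measurable C -> measurable (@phi1 R @^-1` C).
Proof. by move=> mC; rewrite -[X in measurable X]setTI; exact: measurable_phi1. Qed.

Lemma lebesgue_fin01 C : measurable C -> C `<=` `[0, 1] -> leb C \is a fin_num.
Proof.
move=> mC C01; rewrite ge0_fin_numE// (@le_lt_trans _ _ (leb `[0, 1]))//.
  by apply: le_measure => //; exact: mem_set.
by rewrite lebesgue_measure_itv/= lte01 oppr0 addr0 ltry.
Qed.

(** The affine branch [i] sends [2 ^- i] to 0 and [2 ^- i * (1 + y)] to [y], so the interval is the
    part of the branch lying over [[0, y[]; [y = 1] gives the whole branch. *)
Lemma phi1_preimage_branch i y C : (2 <= i)%N -> 0 <= y <= 1 ->
  `[2 ^- i, 2 ^- i * (1 + y)[ `&` @phi1 R @^-1` C =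
  (fun x => 2 ^+ i * (x - 2 ^- i)) @^-1` (C `&` `[0, y[).
Proof.
move=> i2 /andP[y0 y1]; have p0 : 0 < 2 ^+ i :> R by rewrite exprn_gt0.
have xyE x : (x < 2 ^- i * (1 + y)) = (2 ^+ i * (x - 2 ^- i) < y).
  by rewrite mulrDr mulr1 -ltrBlDl mulrC ltr_pdivlMr// mulrC.
have x0E x : (2 ^- i <= x) = (0 <= 2 ^+ i * (x - 2 ^- i)).
  by rewrite pmulr_rge0// subr_ge0.
have phiE x : 2 ^- i <= x < 2 ^- i * (1 + y) -> phi1 x = 2 ^+ i * (x - 2 ^- i).
  move=> /andP[ix xi]; apply: phi1_branch => //.
  rewrite in_itv/= ix (lt_le_trans xi)//.
  rewrite -[in leRHS](prednK (ltnW i2)) /=.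
  have -> : 2 ^- i.-1 = 2 ^- i * 2 :> R.
    by rewrite -{2}(prednK (ltnW i2)) exprS invfM mulrAC mulVf ?mul1r// pnatr_eq0.
  by rewrite ler_pM2l ?invr_gt0//; lra.
apply/seteqP; split=> x /=; rewrite !in_itv/= -xyE -x0E.
  by move=> [ixy Cx]; rewrite -phiE.
by move=> [Cx ixy]; rewrite phiE.
Qed.

Lemma lebesgue_phi1_branch i y C : measurable C -> (2 <= i)%N -> 0 <= y <= 1 ->
  leb (`[2 ^- i, 2 ^- i * (1 + y)[ `&` @phi1 R @^-1` C) =
  ((2 ^- i)%:E * leb (C `&` `[0%R, y[))%E.
Proof.
move=> mC i2 y01; rewrite phi1_preimage_branch// lebesgue_measure_affine//.
exact: measurableI.
Qed.

Lemma lebesgue_itv_cat (a b c : R) P : measurable P -> a <= b <= c ->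
  leb (`[a, c[ `&` P) = (leb (`[a, b[ `&` P) + leb (`[b, c[ `&` P))%E.
Proof.
move=> mP /andP[ab bc]; rewrite -measureU; first last.
- apply/seteqP; split=> x //= -[[]]; rewrite !in_itv/= => /andP[_ xb] _.
  by move=> [/andP[bx _] _]; move: (le_lt_trans bx xb); rewrite ltxx.
- exact: measurableI.
- exact: measurableI.
rewrite -setIUl; congr (leb (_ `&` _)); apply/seteqP; split=> x /=; rewrite !in_itv/=.
  by move=> /andP[x0 xj]; have [xb|xb] := ltP x b; [left; rewrite x0|right].
case=> /andP[ax xb]; first by rewrite ax (lt_le_trans xb).
by rewrite xb andbT (le_trans ab).
Qed.

(** Up to the point 0, the interval is the union of the branches [j > i]; each contributes [2 ^- j]
    times the measure of [C] in [[0, 1[], and these factors sum to [2 ^- i]. *)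
Lemma lebesgue_phi1_prefix i C : measurable C -> (0 < i)%N ->
  leb (`[0, 2 ^- i[ `&` @phi1 R @^-1` C) = ((2 ^- i)%:E * leb (C `&` `[0%R, 1%R[))%E.
Proof.
move=> mC i0; pose G j := fine (leb (`[0, 2 ^- j[ `&` @phi1 R @^-1` C)).
have mphi := measurable_phi1_preimage mC.
have pow_le1 j : 2 ^- j <= 1 :> R by rewrite invf_le1 ?exprn_gt0// exprn_ege1 ?ler1n.
have finG j : leb (`[0, 2 ^- j[ `&` @phi1 R @^-1` C) \is a fin_num.
  apply: lebesgue_fin01; first exact: measurableI.
  by move=> x [/=]; rewrite !in_itv/= => /andP[-> /ltW/le_trans->].
have finK : leb (C `&` `[0, 1[) \is a fin_num.
  apply: lebesgue_fin01; first exact: measurableI.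
  by move=> x [/=]; rewrite !in_itv/= => _ /andP[-> /ltW->].
set k := fine (leb (C `&` `[0, 1[)).
have G01 j : 0 <= G j <= 2 ^- j.
  rewrite fine_ge0//= -lee_fin fineK//.
  rewrite (@le_trans _ _ (leb `[0, 2 ^- j[))//; last first.
    by rewrite lebesgue_measure_itv/= lte_fin invr_gt0 exprn_gt0//= sube0.
  by apply: measureIl => //; exact: measurable_itv.
(* One full branch, number [j.+1], is split off; [0 < j] makes its index at least 2. *)
have GS j : (0 < j)%N -> G j = G j.+1 + 2 ^- j.+1 * k.
  move=> j0; apply/EFin_inj; rewrite EFinD EFinM !fineK//.
  rewrite -lebesgue_phi1_branch ?lexx ?ler01//.
  have -> : 2 ^- j.+1 * (1 + 1) = 2 ^- j :> R.
    by rewrite exprS invfM mulrAC mulVf ?mul1r// pnatr_eq0.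
  apply: lebesgue_itv_cat => //.
  by rewrite invr_ge0 exprn_ge0//= lef_pV2 ?posrE ?exprn_gt0// ler_eXn2l ?ltr1n.
(* [D j] does not depend on j and is at most 2^-j, hence 0: this replaces the
   summation over all branches. *)
pose D j := G j - 2 ^- j * k.
have DS j : D j.+1 = D j.+2.
  by rewrite /D (GS j.+1)// exprS; field; rewrite expf_neq0// pnatr_eq0.
have DE j : D j.+1 = D 1%N by elim: j => // j ih; rewrite -DS.
have k01 : 0 <= k <= 1.
  rewrite fine_ge0//= -lee_fin fineK//.
  rewrite (@le_trans _ _ (leb `[0, 1[))//; last first.
    by rewrite lebesgue_measure_itv/= lte_fin ltr01 sube0.
  by apply: measureIr => //; exact: measurable_itv.
have Dle j : `|D j| <= 2 ^- j.
  have p0 : 0 < 2 ^- j :> R by rewrite invr_gt0 exprn_gt0.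
  by have := G01 j; rewrite ler_norml /D; nra.
have D0 : D 1%N = 0.
  apply/eqP; rewrite -normr_le0; apply/ler_addgt0Pr => e e0; rewrite add0r.
  have [n ne] : exists n, 2 ^- n.+1 < e.
    exists (Num.bound e^-1); rewrite invf_plt ?posrE ?exprn_gt0//.
    rewrite (lt_trans (archi_boundP _)) ?invr_ge0 ?ltW//.
    by rewrite -natrX ltr_nat (ltn_trans (ltn_expl _ (isT : 1 < 2)%N))// ltn_exp2l.
  by rewrite -(DE n) (le_trans (Dle _))// ltW.
rewrite -[LHS]fineK// -[X in (_ * X)%E]fineK// -EFinM; congr EFin.
by move: (DE i.-1); rewrite D0 prednK// /D => /eqP; rewrite subr_eq0 => /eqP.
Qed.

Lemma lebesgue_phi1_left C : measurable C ->
  leb (`[0, 1 / 2[ `&` @phi1 R @^-1` C) = ((1 / 2)%:E * leb (C `&` `[0%R, 1%R[))%E.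
Proof. by move=> mC; have := @lebesgue_phi1_prefix 1 C mC isT; rewrite expr1 mul1r. Qed.

Lemma lebesgue_phi1_right C : measurable C ->
  leb (`[1 / 2, 1] `&` @phi1 R @^-1` C) = leb (C `&` `[0%R, (1 / 2)%R]).
Proof.
move=> mC; have mCI : measurable (C `&` `[0, 1 / 2]) by exact: measurableI.
have := lebesgue_measure_affine (1 / 2) ltr01 mCI; rewrite invr1 mul1e => <-.
congr (leb _); apply/seteqP; split=> x /=; rewrite !in_itv/= [1 * (_ - _)]mul1r.
  move=> [x01]; rewrite phi1_right ?in_itv//= => Cx; split => //; lra.
move=> [Cx x01]; have x2 : 1 / 2 <= x <= 1 by lra.
by split => //; rewrite phi1_right// in_itv.
Qed.

(** The interval consists of all branches beyond [i] and the part of branch [i] over [[0, y[]. Every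
    point of []0, 1/2[] occurs as such a right end. *)
Lemma lebesgue_phi1_itv i y C : measurable C -> (2 <= i)%N -> 0 <= y <= 1 ->
  leb (`[0, 2 ^- i * (1 + y)[ `&` @phi1 R @^-1` C) =
  ((2 ^- i)%:E * (leb (C `&` `[0%R, 1%R[) + leb (C `&` `[0%R, y[)))%E.
Proof.
move=> mC i2 y01.
rewrite muleDr//; last by rewrite ge0_adde_def// inE.
rewrite -lebesgue_phi1_prefix//; last exact: ltnW.
rewrite -lebesgue_phi1_branch//.
rewrite -lebesgue_itv_cat//; first exact: measurable_phi1_preimage.
have p0 : 0 < 2 ^- i :> R by rewrite invr_gt0 exprn_gt0.
by rewrite (ltW p0)/= ler_peMr ?(ltW p0)// lerDl; case/andP: y01.
Qed.

End phi1_measure.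

(** * The first return map to [[0, 1/2[] and its mixing rate *)

Section first_return.
Context {R : realType}.
Implicit Types (B C E : set R) (x y : R).

Local Notation leb := (@lebesgue_measure R).

(** For [B] in []0, 1/2[] this is the part of [[1/2, 1]] that [phi1] sends into [B]. *)
Definition half_shift B : set R := (fun x => x - 1 / 2) @^-1` B.

(* The first return map of phi1 to [0, 1/2[ is x |-> phi1 x, or phi1 x - 1/2 when
   phi1 x >= 1/2.  The sets B below lie in the open interval ]0, 1/2[, so that
   half_shift B does not contain 1/2 = phi1 1. *)
Definition return_preimage B : set R :=
  `[0, 1 / 2[ `&` @phi1 R @^-1` (B `|` half_shift B).

Lemma measurable_half_shift B : measurable B -> measurable (half_shift B).
Proof.
move=> mB; rewrite -[X in measurable X]setTI.
have : measurable_fun setT (fun x : R => x - 1 / 2) by exact: measurable_funB.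
exact.
Qed.

Lemma measurable_return_preimage B : measurable B -> measurable (return_preimage B).
Proof.
move=> mB; apply: measurableI => //; apply: measurable_phi1_preimage.
by apply: measurableU => //; exact: measurable_half_shift.
Qed.

(** Only 0 has to be excluded: [phi1] fixes it, and it lies in neither [B] nor [half_shift B]. This
    lets the preimage be iterated. *)
Lemma return_preimage_sub B : B `<=` `]0, 1 / 2[ -> return_preimage B `<=` `]0, 1 / 2[.
Proof.
move=> BI x [/=]; rewrite /half_shift/= !in_itv/= => /andP[]; rewrite le_eqVlt.
move=> /predU1P[<-|->//] _; rewrite phi1_0 => -[] /BI /=; rewrite in_itv/= => ?; lra.
Qed.

Let lebesgue_half_shift B : measurable B -> leb (half_shift B) = leb B.
Proof.
move=> mB; have := lebesgue_measure_affine (1 / 2) ltr01 mB.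
rewrite invr1 mul1e => <-; congr (leb _).
by apply/seteqP; split=> x /=; rewrite /half_shift/= [1 * (_ - _)]mul1r.
Qed.

(** The copies [B] and [half_shift B] lie on opposite sides of 1/2, so an initial interval reaches
    the second copy only past 1/2. *)
Let lebesgue_low B y : B `<=` `]0, 1 / 2[ -> y <= 1 / 2 ->
  leb ((B `|` half_shift B) `&` `[0, y[) = leb (B `&` `[0, y[).
Proof.
move=> BI y2; congr (leb _); apply/seteqP; split=> x /=; last by tauto.
move=> [[Bx //|]]; rewrite /half_shift/= => /BI /=; rewrite !in_itv/= => ? ?.
by exfalso; lra.
Qed.

Let lebesgue_high B y : measurable B -> B `<=` `]0, 1 / 2[ -> 1 / 2 <= y <= 1 ->
  leb ((B `|` half_shift B) `&` `[0, y[) =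
  (leb B + leb (B `&` `[0%R, (y - 1 / 2)%R[))%E.
Proof.
move=> mB BI /andP[y2 y1].
have mBy : measurable (B `&` `[0, y - 1 / 2[) by exact: measurableI.
rewrite -(lebesgue_half_shift mBy) -measureU//; first last.
- apply/seteqP; split=> x //= -[/BI /=]; rewrite /half_shift/= !in_itv/= => ? [_ ?]; lra.
- exact: measurable_half_shift.
congr (leb _); apply/seteqP; split=> x /=; rewrite /half_shift/=.
  move=> [[Bx|Bx]]; first by left.
  move=> xy; right; split=> //; move: xy (BI _ Bx) => /=; rewrite !in_itv/=; lra.
case=> [Bx|[Bx xy]]; split; [by left| |by right|].
  by move: (BI _ Bx) => /=; rewrite !in_itv/=; lra.
by move: xy; rewrite !in_itv/=; lra.
Qed.

Let lebesgue_full B : measurable B -> B `<=` `]0, 1 / 2[ ->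
  leb ((B `|` half_shift B) `&` `[0, 1[) = (leb B + leb B)%E.
Proof.
move=> mB BI; rewrite lebesgue_high//; last by rewrite lexx andbT; lra.
congr (_ + leb _)%E; apply/setIidPl => x /BI /=; rewrite !in_itv/=; lra.
Qed.

(** The left branches halve the measure, and two copies of [B] are pulled back. *)
Lemma lebesgue_return_preimage B : measurable B -> B `<=` `]0, 1 / 2[ ->
  leb (return_preimage B) = leb B.
Proof.
move=> mB BI; rewrite lebesgue_phi1_left; last first.
  by apply: measurableU => //; exact: measurable_half_shift.
rewrite lebesgue_full// -mule2n -[(leb B *+ 2)%E]mule_natl muleA -EFinM.
by rewrite mul1r mulVf ?mul1e// pnatr_eq0.
Qed.

(* Zero when [0, x[ and B are independent for the normalized Lebesgue measure
   on [0, 1/2[. *)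
Let defect B x : R := fine (leb (B `&` `[0, x[)) - 2 * x * fine (leb B).

Let fin_half B x : measurable B -> B `<=` `]0, 1 / 2[ ->
  leb (B `&` `[0, x[) \is a fin_num.
Proof.
move=> mB BI; apply: lebesgue_fin01; first exact: measurableI.
by move=> z [/BI /=]; rewrite !in_itv/= => ? _; lra.
Qed.

Let fin_sub B : measurable B -> B `<=` `]0, 1 / 2[ -> leb B \is a fin_num.
Proof.
move=> mB BI; apply: lebesgue_fin01 => // z /BI /=; rewrite !in_itv/= => ?; lra.
Qed.

(** With [x = 2 ^- i * (1 + y)], the branches beyond [i] contribute [2 ^- i * 2 |B|], which cancels
    against [2 x |B|] except for [2 ^- i * 2 y |B|]. What remains is [2 ^- i] times the defect of
    [B] at [y], or at [y - 1/2] once the first copy of [B] is passed. Since [i >= 2], the factor is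
    at most 1/4. *)
Let defectS B x : measurable B -> B `<=` `]0, 1 / 2[ -> 0 <= x <= 1 / 2 ->
  exists2 y, 0 <= y <= 1 / 2 &
    `|defect (return_preimage B) x| <= 4^-1 * `|defect B y|.
Proof.
move=> mB BI /andP[]; have mtB := measurable_return_preimage mB.
have tBI := return_preimage_sub BI.
have z2 : 0 <= (0 : R) <= 1 / 2 by rewrite lexx divr_ge0.
(* The ends 0 and 1/2 lie in no branch of [phi1_cover]; the defect vanishes at both, so the witness
   0 is arbitrary. *)
rewrite le_eqVlt => /predU1P[<- _|x0].
  exists 0 => //; rewrite [X in `|X|](_ : _ = 0) ?normr0 ?mulr_ge0 ?invr_ge0//.
  by rewrite /defect mulr0 mul0r subr0 set_itvco0 setI0 measure0.
rewrite le_eqVlt => /predU1P[->|x2].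
  exists 0 => //; rewrite [X in `|X|](_ : _ = 0) ?normr0 ?mulr_ge0 ?invr_ge0//.
  rewrite /defect; have /setIidPl -> : return_preimage B `<=` `[0, 1 / 2[.
    by apply: subIsetl.
  by rewrite mul1r mulfV ?pnatr_eq0// mul1r subrr.
have [i i2] : exists2 i, (2 <= i)%N & x \in `[2 ^- i, 2 ^- i.-1[.
  by apply: phi1_cover; rewrite x0.
rewrite in_itv/= => /andP[ix xi].
have p0 : 0 < 2 ^+ i :> R by rewrite exprn_gt0.
have p0' : 0 <= 2 ^- i :> R by rewrite invr_ge0 ltW.
(* This is the value [phi1 x]. *)
pose y := 2 ^+ i * x - 1.
have xE : x = 2 ^- i * (1 + y) by rewrite /y; field; rewrite gt_eqF.
have y0 : 0 <= y by rewrite subr_ge0 mulrC -ler_pdivrMr// mul1r.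
have y1 : y <= 1.
  have : 2 ^+ i * x <= 2 ^+ i * 2 ^- i.-1 by rewrite ler_pM2l// ltW.
  rewrite -{2}(prednK (ltnW i2)) exprS mulfK ?expf_neq0 ?pnatr_eq0//.
  by rewrite /y; lra.
have pi4 : 2 ^- i <= 4^-1 :> R.
  have -> : 4 = 2 ^+ 2 :> R by ring.
  by rewrite lef_pV2 ?posrE ?exprn_gt0// ler_eXn2l ?ltr1n.
set b := fine (leb B).
pose C := B `|` half_shift B.
have mC : measurable C by apply: measurableU => //; exact: measurable_half_shift.
have tBx : leb (return_preimage B `&` `[0, x[) =
    ((2 ^- i)%:E * (leb B + leb B + leb (C `&` `[0%R, y[)))%E.
  rewrite -lebesgue_full// -/C -lebesgue_phi1_itv ?y0// -xE.
  congr (leb _); rewrite /return_preimage -/C; apply/seteqP; split=> z /=.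
    by move=> [[_ Cz] zx]; split.
  move=> [zx Cz]; split=> //; split=> //.
  by move: zx; rewrite !in_itv/= => /andP[-> /lt_trans->].
have [y2|y2] := leP y (1 / 2).
  exists y; first by rewrite y0.
  have -> : defect (return_preimage B) x = 2 ^- i * defect B y.
    rewrite /defect lebesgue_return_preimage// tBx lebesgue_low//.
    rewrite -(fineK (fin_sub mB BI)) -(fineK (fin_half y mB BI)) -!EFinD -EFinM/=.
    by rewrite -/b xE; field; rewrite gt_eqF.
  by rewrite normrM (ger0_norm p0') ler_wpM2r.
exists (y - 1 / 2); first lra.
have -> : defect (return_preimage B) x = 2 ^- i * defect B (y - 1 / 2).
  rewrite /defect lebesgue_return_preimage// tBx lebesgue_high//; last by rewrite ltW.
  rewrite -(fineK (fin_sub mB BI)) -(fineK (fin_half (y - 1 / 2) mB BI)) -!EFinD -EFinM/=.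
  by rewrite -/b xE; field; rewrite gt_eqF.
by rewrite normrM (ger0_norm p0') ler_wpM2r.
Qed.

Lemma iter_return_preimage n B : measurable B -> B `<=` `]0, 1 / 2[ ->
  [/\ measurable (iter n return_preimage B),
      iter n return_preimage B `<=` `]0, 1 / 2[ &
      leb (iter n return_preimage B) = leb B].
Proof.
move=> mB BI; elim: n => [|n [mn nI nB]] //=; split.
- exact: measurable_return_preimage.
- exact: return_preimage_sub.
- by rewrite lebesgue_return_preimage.
Qed.

Let defect_iter n B x : measurable B -> B `<=` `]0, 1 / 2[ -> 0 <= x <= 1 / 2 ->
  `|defect (iter n return_preimage B) x| <= 4^-1 ^+ n.
Proof.
(* The induction is over all [x], because [defectS] moves the point. *)
move=> mB BI; elim: n x => [|n ih] x x01 /=; last first.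
  have [mn nI _] := iter_return_preimage n mB BI.
  have [y y01 /le_trans->//] := defectS mn nI x01.
  by rewrite exprS ler_wpM2l// ih.
(* Base case: both measures are at most 1/2 and [2 * x <= 1], so the defect is at most 1 in absolute
   value. *)
have le1 E : measurable E -> E `<=` `[0, 1 / 2] -> 0 <= fine (leb E) <= 1 / 2.
  move=> mE EI; have E1 : leb E \is a fin_num.
    by apply: lebesgue_fin01 => // z /EI/=; rewrite !in_itv/= => ?; lra.
  rewrite fine_ge0//= -lee_fin fineK// (@le_trans _ _ (leb `[0, 1 / 2]))//.
    by apply: le_measure => //; exact: mem_set.
  by rewrite lebesgue_measure_itv/= lte_fin; case: ifP => _; rewrite ?sube0// lee_fin; lra.
have b01 : 0 <= fine (leb B) <= 1 / 2.
  by apply: le1 => // z /BI /=; rewrite !in_itv/= => ?; lra.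
have bx01 : 0 <= fine (leb (B `&` `[0, x[)) <= 1 / 2.
  by apply: le1; [exact: measurableI|move=> z [/BI /=]; rewrite !in_itv/= => ? _; lra].
rewrite ler_norml /defect; set u := fine _ in bx01 *; set v := fine _ in b01 *.
nra.
Qed.

(** The Dynkin argument is applied to Lebesgue measure restricted to []0, 1/2[], with the rays
    []-oo, x[] as generators: each meets []0, 1/2[] in an initial interval, where the defect tends
    to 0. *)
Lemma cvg_iter_return_preimage B E : measurable B -> B `<=` `]0, 1 / 2[ -> measurable E ->
  fine (leb (E `&` iter n return_preimage B)) @[n --> \oo] -->
    2 * fine (leb B) * fine (leb (E `&` `]0, (1 / 2)%R[)).
Proof.
move=> mB BI mE.
pose D : set R := `]0, 1 / 2[%classic.
have lebD : leb D = (1 / 2)%:E.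
  by rewrite lebesgue_measure_itv/= lte_fin ifT ?sube0//; lra.
have mD : measurable D by exact: measurable_itv.
have Doo : (leb D < +oo)%E by rewrite lebD ltry.
pose mu : {finite_measure set _ -> \bar R} := @mfrestr _ (measurableTypeR R) R D leb mD Doo.
pose A n := iter n return_preimage B.
have mA n : measurable (A n) by have [] := iter_return_preimage n mB BI.
have AD n : A n `<=` D by have [] := iter_return_preimage n mB BI.
have muA F n : mu (F `&` A n) = leb (F `&` A n).
  by congr (leb _); apply/setIidPl => x [_ /AD].
rewrite (_ : (fun n => _) = (fun n => fine (mu (E `&` A n)))); last first.
  by apply/funext => n; rewrite muA.
apply: (@cvg_measureI_dynkin _ _ _ mu A _ mA _ _ (RGenInftyO.measurableE R)) => //.
(* The whole space: [2 |B| * (1/2) = |B|], and every iterated preimage has measure [|B|]. *)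
- have -> : mu setT = (1 / 2)%:E by rewrite /mu /= /mfrestr /mrestr setTI.
  rewrite /= mulrAC [2 * _](_ : _ = 1) ?mul1r; last by rewrite mulfV// pnatr_eq0.
  under eq_fun.
    move=> n; rewrite muA setTI /A.
    have [_ _ ->] := iter_return_preimage n mB BI.
    over.
  exact: cvg_cst.
- move=> _ _ [x ->] [y ->]; exists (Num.min x y); apply/seteqP; split=> z /=;
  by rewrite !in_itv/= lt_min => /andP.
(* Truncating [x] to [[0, 1/2]] does not change the trace of the ray on []0, 1/2[]. *)
move=> _ [x ->]; pose y := Num.min (Num.max x 0) (1 / 2).
have y01 : 0 <= y <= 1 / 2.
  by rewrite /y le_min le_max lexx orbT ge_min lexx orbT divr_ge0.
have lty z : 0 < z < 1 / 2 -> (z < x) = (z < y).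
  by move=> /andP[z0 z2]; rewrite /y lt_min lt_max z2 andbT (lt_gtF z0) orbF.
have -> : mu `]-oo, x[%classic = y%:E.
  rewrite [LHS](_ : _ = leb `]0, y[).
    rewrite lebesgue_measure_itv/= lte_fin; case: ltP => [_|y0]; first by rewrite sube0.
    by congr EFin; lra.
  congr (leb _); apply/seteqP; split=> z /=; rewrite !in_itv/=.
    by move=> [zx z02]; rewrite -lty// zx andbT; case/andP: z02.
  move=> z0y; have z02 : 0 < z < 1 / 2 by lra.
  by rewrite lty//; split => //; lra.
rewrite [X in X @ _](_ : _ = (fun n => defect (A n) y + 2 * y * fine (leb B))); last first.
  apply/funext => n; rewrite muA /defect /A.
  have [_ nI ->] := iter_return_preimage n mB BI.
  rewrite subrK; congr (fine (leb _)); apply/seteqP; split=> z /=; rewrite !in_itv/=.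
    by move=> [zx /[dup] nz /nI/=]; rewrite in_itv/= => z02; rewrite -lty// zx andbT;
       split=> //; rewrite ltW//; case/andP: z02.
  by move=> [/[dup] nz /nI/=]; rewrite in_itv/= => z02 ?; rewrite lty//; split=> //; lra.
rewrite [X in _ --> X](_ : _ = 0 + 2 * y * fine (leb B)); last by rewrite add0r mulrAC.
apply: cvgD; last exact: cvg_cst.
apply/norm_cvg0P.
apply: (@squeeze_cvgr _ _ _ _ (cst 0) (fun n => 4^-1 ^+ n)).
- by apply: nearW => n; rewrite normr_ge0 defect_iter.
- exact: cvg_cst.
- by apply: cvg_expr; rewrite ger0_norm; lra.
Qed.

End first_return.

(** * Uniqueness of the invariant density *)

Section uniqueness.
Context {R : realType}.
Implicit Types (A B C E F : set R) (x y : R).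
Variable rho : R -> R.
Hypothesis rho_inv : invariant_density phi1 rho.

Local Notation leb := (@lebesgue_measure R).
Local Notation mu := (density_measure rho).

Let rho_measurable E : measurable E -> E `<=` `[0, 1] ->
  measurable_fun E (EFin \o rho).
Proof.
move=> mE E01; apply/measurable_EFinP.
by case: rho_inv => -[mrho _ _] _; exact: (measurable_funS _ E01 mrho).
Qed.

Let rho_ge0 x : x \in `[0, 1] -> (0 <= (rho x)%:E)%E.
Proof. by case: rho_inv => -[_ rho0 _] _ x01; rewrite lee_fin rho0. Qed.

Let mu1 : mu `[0, 1] = 1%E.
Proof. by case: rho_inv => -[]. Qed.

Let mu_inv A : measurable A -> A `<=` `[0, 1] -> mu (`[0, 1] `&` phi1 @^-1` A) = mu A.
Proof. by case: rho_inv => _ + mA A01; apply. Qed.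

Let muU E F : measurable E -> measurable F -> E `<=` `[0, 1] -> F `<=` `[0, 1] ->
  E `&` F = set0 -> mu (E `|` F) = (mu E + mu F)%E.
Proof.
move=> mE mF E01 F01 EF; apply: ge0_integral_setU => //.
- by apply: rho_measurable; [exact: measurableU|rewrite subUset].
- by move=> x [/E01|/F01]; exact: rho_ge0.
- by apply/disj_setPS; rewrite EF.
Qed.

Let mu_ge0 E : E `<=` `[0, 1] -> (0 <= mu E)%E.
Proof. by move=> E01; apply: integral_ge0 => x /E01; exact: rho_ge0. Qed.

Let mu_fin E : measurable E -> E `<=` `[0, 1] -> mu E \is a fin_num.
Proof.
move=> mE E01; rewrite ge0_fin_numE ?mu_ge0//.
have : (mu E <= mu `[0%R, 1%R])%E.
  apply: ge0_subset_integral => //; exact: rho_measurable.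
by rewrite mu1 => /le_lt_trans; apply; exact: ltry.
Qed.

(** The full preimage of [B] together with [half_shift B] is [return_preimage B] together with the
    same [half_shift B]. Invariance equates the two masses, and the finite mass of [half_shift B]
    cancels. *)
Let mu_return B : measurable B -> B `<=` `]0, 1 / 2[ -> mu (return_preimage B) = mu B.
Proof.
move=> mB BI.
have mS := measurable_half_shift mB.
have mP := measurable_return_preimage mB.
have PI := return_preimage_sub BI.
have S1 x : half_shift B x -> 1 / 2 < x < 1.
  by rewrite /half_shift/= => /BI/=; rewrite in_itv/= => ?; lra.
have S01 : half_shift B `<=` `[0, 1].
  by move=> x /S1 /=; rewrite in_itv/= => ?; lra.
have B01 : B `<=` `[0, 1] by move=> x /BI/=; rewrite !in_itv/= => ?; lra.
have P01 : return_preimage B `<=` `[0, 1].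
  by move=> x /PI/=; rewrite !in_itv/= => ?; lra.
have := mu_inv (measurableU _ _ mB mS); rewrite subUset => /(_ (conj B01 S01)).
have -> : `[0, 1] `&` phi1 @^-1` (B `|` half_shift B) = return_preimage B `|` half_shift B.
  apply/seteqP; split=> x /=.
    move=> [x01 phix]; have [x2|x2] := ltP x (1 / 2).
      by left; split => //=; move: x01; rewrite !in_itv/= x2 => /andP[->].
    move: x01; rewrite in_itv/= => /andP[_ x1].
    have pE : phi1 x = x - 1 / 2 by apply: phi1_right; rewrite in_itv/= x2.
    by case: phix; rewrite pE; [right|move=> /S1 ?; lra].
  case=> [[/= x02 phix]|Sx].
    by split=> //; move: x02; rewrite !in_itv/= => /andP[-> /ltW/le_trans->//]; lra.
  have := S1 _ Sx; rewrite in_itv/= => x12; split; first lra.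
  by left; rewrite phi1_right ?in_itv//=; lra.
have BS0 : B `&` half_shift B = set0.
  apply/seteqP; split=> x //= -[/BI/=].
  by rewrite in_itv/= => /andP[_ x2] /S1/andP[/(lt_trans x2)]; rewrite ltxx.
have PS0 : return_preimage B `&` half_shift B = set0.
  apply/seteqP; split=> x //= -[/PI/=].
  by rewrite in_itv/= => /andP[_ x2] /S1/andP[/(lt_trans x2)]; rewrite ltxx.
rewrite !muU//.
move=> /(congr1 (fun z => z - mu (half_shift B))%E).
by rewrite !addeK// mu_fin.
Qed.

Let mu_iter_return n B : measurable B -> B `<=` `]0, 1 / 2[ ->
  mu (iter n return_preimage B) = mu B.
Proof.
move=> mB BI; elim: n => //= n ih.
by have [mn nI _] := iter_return_preimage n mB BI; rewrite mu_return.
Qed.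

Let mu_left_ge B : measurable B -> B `<=` `]0, 1 / 2[ ->
  (((2 * fine (leb B))%:E * mu `]0%R, (1 / 2)%R[) <= mu B)%E.
Proof.
move=> mB BI.
have D01 : `]0, 1 / 2[ `<=` (`[0, 1] : set R).
  by move=> x /=; rewrite !in_itv/= => ?; lra.
have Doo : (leb `]0%R, (1 / 2)%R[ < +oo)%E.
  by rewrite lebesgue_measure_itv/= lte_fin; case: ifP => _; rewrite ?sube0 ltry.
(* Here [c = 2 |B|] and [v = mu B]; each iterated preimage has mass exactly [v]. *)
apply: (@cvg_measureI_integral_le _ _ _ leb _ (fun n => iter n return_preimage B)) => //.
- by rewrite mulr_ge0// fine_ge0.
- by move=> n; have [] := iter_return_preimage n mB BI.
- by move=> E mE; exact: cvg_iter_return_preimage.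
- exact: rho_measurable.
- by move=> x /D01; exact: rho_ge0.
- by move=> n; rewrite -[X in (X <= _)%E]/(mu _) mu_iter_return.
Qed.

(** The lower bounds for [B] and for its complement in []0, 1/2[] add up to the mass of []0, 1/2[],
    because the two factors sum to 1. Hence both are equalities. *)
Let mu_left B : measurable B -> B `<=` `]0, 1 / 2[ ->
  mu B = ((2 * fine (leb B))%:E * mu `]0%R, (1 / 2)%R[)%E.
Proof.
move=> mB BI; pose D : set R := `]0, 1 / 2[%classic.
have mD : measurable D by exact: measurable_itv.
have D01 : D `<=` `[0, 1] by move=> x; rewrite /D/= !in_itv/= => ?; lra.
have B01 : B `<=` `[0, 1] by move=> x /BI /D01.
have DB01 : D `\` B `<=` `[0, 1] by move=> x [/D01].
have mDB : measurable (D `\` B) by exact: measurableD.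
have muD : mu D = (mu B + mu (D `\` B))%E.
  by rewrite -muU// ?setDIK// setDUK.
have lebDE : leb D = (1 / 2)%:E.
  by rewrite /D lebesgue_measure_itv/= lte_fin ifT ?sube0//; lra.
have lebD : fine (leb (D `\` B)) = 1 / 2 - fine (leb B).
  apply/EFin_inj; rewrite fineK; last exact: lebesgue_fin01.
  rewrite measureD//; last by rewrite -ge0_fin_numE//; exact: lebesgue_fin01.
  rewrite setIidr// EFinB fineK; last exact: lebesgue_fin01.
  by congr (_ - _)%E.
have leB := mu_left_ge mB BI; have leDB := mu_left_ge mDB (@subDsetl _ _ _).
move: muD leB leDB; rewrite -/D lebD -(fineK (mu_fin mD D01)) -(fineK (mu_fin mB B01)).
rewrite -(fineK (mu_fin mDB DB01)) -!EFinM -EFinD !lee_fin => -[muD] leB leDB.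
by congr EFin; move: muD leB leDB; nra.
Qed.

(** [phi1] maps [[1/2, 1]] into [[0, 1/2]], so the preimage [S] of [C] lies in the left half; there
    [|S| = |C| / 2], and [mu_left] gives the factor [2 |S| = |C|]. *)
Let mu_right C : measurable C -> C `<=` `]1 / 2, 1[ ->
  mu C = ((fine (leb C))%:E * mu `]0%R, (1 / 2)%R[)%E.
Proof.
move=> mC CI.
have C01 : C `<=` `[0, 1] by move=> x /CI/=; rewrite !in_itv/= => ?; lra.
have CE : C `&` `[0, 1[ = C.
  by apply/setIidPl => x /CI/=; rewrite !in_itv/= => ?; lra.
pose S := `[0, 1 / 2[ `&` @phi1 R @^-1` C.
have mS : measurable S by apply: measurableI => //; exact: measurable_phi1_preimage.
have SI : S `<=` `]0, 1 / 2[.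
  move=> x [/=]; rewrite !in_itv/= => /andP[]; rewrite le_eqVlt.
  by move=> /predU1P[<-|->//] _; rewrite phi1_0 => /CI/=; rewrite in_itv/= => ?; lra.
have SE : `[0, 1] `&` phi1 @^-1` C = S.
  apply/seteqP; split=> x [/=]; rewrite !in_itv/= => x01 Cx; last by split=> //; lra.
  split=> //=; have [x2|x2] := ltP x (1 / 2); first by rewrite in_itv/= x2; case/andP: x01 => ->.
  move: Cx; rewrite phi1_right ?in_itv/= ?x2; last by case/andP: x01.
  by move=> /CI/=; rewrite in_itv/= => ?; lra.
rewrite -(mu_inv mC C01) SE mu_left// lebesgue_phi1_left// CE.
rewrite -(fineK (lebesgue_fin01 mC C01)) -EFinM/=.
by congr (_%:E * _)%E; field.
Qed.

(** If [m] is this mass, the right half has mass [m / 2], and [m + m / 2 = 1]. *)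
Let mu_left_mass : mu `]0, 1 / 2[ = (2 / 3)%:E.
Proof.
have mrho (a b : R) : 0 <= a -> b <= 1 -> measurable_fun `]a, b[ (EFin \o rho).
  move=> a0 b1; apply: rho_measurable => // x /=; rewrite !in_itv/= => /andP[ax xb].
  by rewrite (le_trans a0 (ltW ax)) (le_trans (ltW xb) b1).
have half_ge0 : 0 <= 1 / 2 :> R by [].
have half_le1 : 1 / 2 <= 1 :> R by lra.
have E : `[0, 1]%classic = `[0, 1 / 2[ `|` `[1 / 2, 1] :> set R.
  apply/seteqP; split=> x /=; rewrite !in_itv/=.
    by move=> /andP[x0 x1]; have [x2|x2] := ltP x (1 / 2); [left; rewrite x0|right].
  by case=> ?; lra.
have := mu1; rewrite {1}E muU//; first last.
- by apply/seteqP; split=> x //= []; rewrite !in_itv/= => ? ?; lra.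
- by move=> x /=; rewrite !in_itv/= => ?; lra.
- by move=> x /=; rewrite !in_itv/= => ?; lra.
have -> : mu `[0, 1 / 2[ = mu `]0, 1 / 2[ by apply: integral_itv_bndoo; exact: mrho.
have -> : mu `[1 / 2, 1] = mu `]1 / 2, 1[ by apply: integral_itv_bndoo; exact: mrho.
rewrite (@mu_right `]1 / 2, 1[%classic)// lebesgue_measure_itv/= lte_fin ifT; last lra.
have D01 : `]0, 1 / 2[ `<=` (`[0, 1] : set R).
  by move=> x /=; rewrite !in_itv/= => ?; lra.
rewrite -(fineK (mu_fin _ D01))//= -EFinM -EFinD => -[h]; congr EFin; lra.
Qed.

(** Integrals over all measurable subsets of [D] determine an integrable function almost everywhere;
    [rho] is integrable on [D] because it is nonnegative with finite mass. *)
Let ae_cst (D : set R) (k : R) : measurable D -> D `<=` `[0, 1] ->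
  (forall E, measurable E -> E `<=` D -> mu E = (k%:E * leb E)%E) ->
  {ae leb, forall x, D x -> rho x = k}.
Proof.
move=> mD D01 muE.
have : ae_eq leb D (EFin \o rho) (cst k%:E).
  apply: integral_ae_eq => //.
    apply/integrableP; split; first exact: rho_measurable.
    have := mu_fin mD D01; rewrite ge0_fin_numE ?mu_ge0//; apply: le_lt_trans.
    rewrite le_eqVlt; apply/orP; left; apply/eqP/eq_integral => x /set_mem /D01 x01.
    by rewrite gee0_abs//; exact: rho_ge0.
  by move=> E ED mE; rewrite integral_cst// -muE.
by apply: filterS => x Dx /Dx[].
Qed.

Lemma invariant_density_ae : ae_eq01 rho rho1.
Proof.
have D01 : `]0, 1 / 2[ `<=` (`[0, 1] : set R).
  by move=> x /=; rewrite !in_itv/= => ?; lra.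
have D'01 : `]1 / 2, 1[ `<=` (`[0, 1] : set R).
  by move=> x /=; rewrite !in_itv/= => ?; lra.
have ae1 : {ae leb, forall x, `]0, 1 / 2[%classic x -> rho x = 4 / 3}.
  apply: ae_cst => // E mE EI; rewrite mu_left// mu_left_mass.
  rewrite -[in RHS](fineK (lebesgue_fin01 mE (subset_trans EI D01))) -!EFinM.
  by congr EFin; field.
have ae2 : {ae leb, forall x, `]1 / 2, 1[%classic x -> rho x = 2 / 3}.
  apply: ae_cst => // E mE EI; rewrite mu_right// mu_left_mass.
  rewrite -[in RHS](fineK (lebesgue_fin01 mE (subset_trans EI D'01))) -!EFinM.
  by congr EFin; field.
(* The points 0, 1/2 and 1 lie outside both open intervals and are discarded as null sets. *)
have ae_neq (a : R) : {ae leb, forall x, x != a}.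
  exists [set a]; split=> //; first exact: lebesgue_measure_set1.
  by move=> x /= /negP; rewrite negbK => /eqP.
have aeF : Filter (almost_everywhere leb) by exact: ae_filter_ringOfSetsType.
apply: (@filterS3 _ _ aeF _ _ _ _ _ ae1 ae2
  (filterI (ae_neq 0) (filterI (ae_neq (1 / 2)) (ae_neq 1)))).
move=> x rho_left rho_right [x0' [x2 x1']]; rewrite in_itv/= => /andP[x0 x1].
have {x0'}x0 : 0 < x by rewrite lt_neqAle eq_sym x0'.
have {x1'}x1 : x < 1 by rewrite lt_neqAle x1'.
rewrite /rho1; case: ltgtP x2 => // x2 _.
- by apply: rho_left; rewrite /= in_itv/= x0.
- by apply: rho_right; rewrite /= in_itv/= x2.
Qed.

End uniqueness.

(** * Invariance of [rho1] *)

Section existence.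
Context {R : realType}.
Implicit Types (A B E : set R) (x : R).

Local Notation leb := (@lebesgue_measure R).

Let measurable_rho1 : measurable_fun setT (@rho1 R).
Proof. by apply: measurable_fun_ifT => //; exact: measurable_fun_ltr. Qed.

Lemma rho1_gt0 x : 0 < rho1 x.
Proof. by rewrite /rho1; case: ifP => _; lra. Qed.

Lemma density_measure_rho1 B : measurable B -> B `<=` `[0, 1] ->
  density_measure rho1 B =
  ((4 / 3)%:E * leb (B `&` `[0%R, (1 / 2)%R[) +
   (2 / 3)%:E * leb (B `&` `[(1 / 2)%R, 1%R]))%E.
Proof.
move=> mB B01.
have mL : measurable (B `&` `[0, 1 / 2[) by exact: measurableI.
have mH : measurable (B `&` `[1 / 2, 1]) by exact: measurableI.
have BE : B = (B `&` `[0, 1 / 2[) `|` (B `&` `[1 / 2, 1]).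
  rewrite -setIUr; apply/esym/setIidPl => x /B01 /=; rewrite !in_itv/= => /andP[x0 x1].
  by have [x2|x2] := ltP x (1 / 2); [left; rewrite x0|right].
rewrite /density_measure {1}BE ge0_integral_setU//; first last.
- apply/disj_setPS => x [[_ /=] + [_ /=]]; rewrite !in_itv/= => /andP[_ x2] /andP[].
  by rewrite leNgt x2.
- by move=> x _; rewrite lee_fin ltW// rho1_gt0.
- by apply/measurable_EFinP; exact: measurable_funTS.
rewrite -!integral_cst//; congr (_ + _)%E; apply: eq_integral => x /set_mem[_ /=];
  rewrite in_itv/= /rho1 => /andP[x0 x1]; first by rewrite x1.
by rewrite ltNge x0.
Qed.

(** The right end is a null set. This reconciles the closed intervals coming from the right branch
    with the half-open splitting of [[0, 1[]. *)
Let lebesgue_itvcc A (a b : R) : measurable A ->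
  leb (A `&` `[a, b]) = leb (A `&` `[a, b[).
Proof.
move=> mA; have [ab|ba] := leP a b; last first.
  by rewrite !set_itv_ge// bnd_simp ?leNgt ?ba// ltNge ltW.
rewrite -(@setUitv1 _ _ _ _ true)// setIUr measureU0//;
  [exact: measurableI|exact: measurableI|].
apply/eqP; rewrite -measure_le0 -(lebesgue_measure_set1 b).
by apply: measureIr => //; exact: measurable_set1.
Qed.

Lemma invariant_density_rho1 : invariant_density phi1 (@rho1 R).
Proof.
split; first split.
- exact: measurable_funTS.
- by move=> x _; rewrite ltW// rho1_gt0.
- rewrite -[LHS]/(density_measure rho1 _) density_measure_rho1//.
  have /setIidPr -> : `[0, 1 / 2[ `<=` (`[0, 1] : set R).
    by move=> x /=; rewrite !in_itv/= => ?; lra.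
  have /setIidPr -> : `[1 / 2, 1] `<=` (`[0, 1] : set R).
    by move=> x /=; rewrite !in_itv/= => ?; lra.
  rewrite !lebesgue_measure_itv/= !lte_fin !ifT ?sube0; [|lra|lra].
  by rewrite -EFinB -!EFinM -EFinD; congr EFin; field.
move=> A mA A01.
have mP : measurable (`[0, 1] `&` @phi1 R @^-1` A).
  by apply: measurableI => //; exact: measurable_phi1_preimage.
rewrite !density_measure_rho1//.
have -> : `[0, 1] `&` @phi1 R @^-1` A `&` `[0, 1 / 2[ = `[0, 1 / 2[ `&` @phi1 R @^-1` A.
  apply/seteqP; split=> x /=; rewrite !in_itv/=; first by tauto.
  by move=> [x02 Ax]; split => //; split => //; lra.
have -> : `[0, 1] `&` @phi1 R @^-1` A `&` `[1 / 2, 1] = `[1 / 2, 1] `&` @phi1 R @^-1` A.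
  apply/seteqP; split=> x /=; rewrite !in_itv/=; first by tauto.
  by move=> [x02 Ax]; split => //; split => //; lra.
(* With [a] and [b] the measures of [A] in [[0, 1/2[] and [[1/2, 1[], the claim becomes [4/3 * (a +
   b)/2 + 2/3 * a = 4/3 * a + 2/3 * b]. *)
rewrite lebesgue_phi1_left// lebesgue_phi1_right//.
have fin a b : leb (A `&` `[a, b[) \is a fin_num.
  apply: lebesgue_fin01; first exact: measurableI.
  by move=> x [/A01].
have := @lebesgue_itv_cat R 0 (1 / 2) 1 A mA; rewrite !(setIC _ A) => ->; last lra.
rewrite !lebesgue_itvcc// -(fineK (fin 0 (1 / 2))) -(fineK (fin (1 / 2) 1)).
by rewrite -!EFinM -!EFinD; congr EFin; field.
Qed.

End existence.

Theorem proposition1 (R : realType) :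
  invariant_density (@phi1 R) (@rho1 R) /\
  (forall rho : R -> R, invariant_density (@phi1 R) rho ->
     ae_eq01 rho (@rho1 R)).
Proof.
by split=> [|rho]; [exact: invariant_density_rho1|exact: invariant_density_ae].
Qed.
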